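(* Let $n \geq 1$ and let $\mathbf{L}$ be a De~Morgan lattice. A subset $F \subseteq \mathbf{L}$ is a prime $n$-filter if and only if $F = h^{-1}[Q_n]$ for some De~Morgan lattice homomorphism $h\colon \mathbf{L} \to \mathbf{DM}_n$, where $Q_n$ is the designated set of $\boldsymbol{\mathcal{DM}}_n$. Likewise, $F$ is a complete prime $n$-filter iff it is a homomorphic preimage of the designated set of $\boldsymbol{\mathcal{P}}_n$; a consistent prime $n$-filter iff it is a homomorphic preimage of the designated set of $\boldsymbol{\mathcal{K}}_n$; and a classical prime $n$-filter iff it is a homomorphic preimage of the designated set of $\boldsymbol{\mathcal{B}}_n$.
   Context: A De~Morgan lattice is a distributive lattice $(L,\wedge,\vee)$ (not necessarily bounded) with a unary operation $\neg$ satisfying $\neg\neg x = x$, $\neg(x\vee y)=\neg x\wedge\neg y$, $\neg(x\wedge y)=\neg x\vee\neg y$. A structure is a pair $\langle \mathbf{A}, F\rangle$ of an algebra and a subset $F$ (the designated set). $\mathbf{DM}_1$ is the four-element De~Morgan lattice on $\{\mathsf f,\mathsf n,\mathsf b,\mathsf t\}$ with $\mathsf f<\mathsf n<\mathsf t$, $\mathsf f<\mathsf b<\mathsf t$, $\mathsf n,\mathsf b$ incomparable, $\neg\mathsf t=\mathsf f$, $\neg\mathsf f=\mathsf t$, $\neg\mathsf n=\mathsf n$, $\neg\mathsf b=\mathsf b$. Put $\boldsymbol{\mathcal{DM}}_1=\langle\mathbf{DM}_1,\{\mathsf t,\mathsf b\}\rangle$; $\boldsymbol{\mathcal{P}}_1$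 is its substructure with universe $\{\mathsf t,\mathsf b,\mathsf f\}$ (designated $\{\mathsf t,\mathsf b\}$), $\boldsymbol{\mathcal{K}}_1$ the substructure with universe $\{\mathsf t,\mathsf n,\mathsf f\}$ (designated $\{\mathsf t\}$), $\boldsymbol{\mathcal{B}}_1$ the substructure with universe $\{\mathsf t,\mathsf f\}$ (designated $\{\mathsf t\}$). The dual product of structures $\langle\mathbf{A}_i,F_i\rangle$, $i\in I$, is $\langle\prod_i\mathbf{A}_i,\bigcup_i\pi_i^{-1}[F_i]\rangle$ ($\pi_i$ the projections). $\boldsymbol{\mathcal{DM}}_n=\langle\mathbf{DM}_n,Q_n\rangle$, $\boldsymbol{\mathcal{P}}_n$, $\boldsymbol{\mathcal{K}}_n$, $\boldsymbol{\mathcal{B}}_n$ are the $n$-th dual powers of $\boldsymbol{\mathcal{DM}}_1$, $\boldsymbol{\mathcal{P}}_1$, $\boldsymbol{\mathcal{K}}_1$, $\boldsymbol{\mathcal{B}}_1$; e.g. $\mathbf{DM}_n=(\mathbf{DM}_1)^n$ and $\langle a_1,\dots,a_n\rangle\in Q_n$ iff $a_i\in\{\mathsf t,\mathsf b\}$ for some $i$. An $n$-filter on a De~Morgan lattice is an upset $F$ such that for every non-empty finite $Y\subseteq L$: if $\bigwedge X\in F$ for every non-empty $X\subseteq Y$ with $|X|\le n$, then $\bigwedge Y\in F$. An upset $F$ is prime if $x\vee y\in F$ implies $x\in F$ or $y\in F$ (so $\emptyset$ is prime). An upset $F$ is almost complete if $x\in F$ implies $x\wedge(y\vee\neg y)\in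 F$; complete if almost complete and non-empty; almost consistent if $(x\wedge\neg x)\vee y\in F$ implies $y\in F$; consistent if almost consistent and $F\neq L$; classical if complete and consistent. *)

(* Defs.v *)
From HB Require Import structures.
From mathcomp Require Import all_boot all_order finmap.
From mathcomp Require Import boolp classical_sets.

Set Implicit Arguments.
Unset Strict Implicit.
Unset Printing Implicit Defensive.

Import Order.TTheory.
Local Open Scope order_scope.

HB.mixin Record hasDeMorganNeg (d : Order.disp_t) L
    of Order.DistrLattice d L := {
  neg : L -> L;
  negK : involutive neg;
  negU : forall x y : L, neg (x `|` y) = neg x `&` neg y;
  negI : forall x y : L, neg (x `&` y) = neg x `|` neg y;
}.

#[short(type="deMorganLatticeType")]
HB.structure Definition DeMorganLattice (d : Order.disp_t) :=
  {L of hasDeMorganNeg d L & Order.DistrLattice d L}.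

Definition demorgan_morphism (d d' : Order.disp_t) (L : deMorganLatticeType d)
    (M : deMorganLatticeType d') (h : L -> M) : Prop :=
  [/\ Order.meet_morphism h, Order.join_morphism h & {morph h : x / neg x}].

Record structure (d : Order.disp_t) := Structure {
  algebra :> deMorganLatticeType d;
  designated : set algebra
}.
Arguments designated {d} A _ : rename.

Section Substructure.
Variable d : Order.disp_t.

Definition subuniverse (L : deMorganLatticeType d) (U : {pred L}) : Prop :=
  [/\ Order.ClosedPredicates.meet_closed U, Order.ClosedPredicates.join_closed U
    & {in U, forall x, neg x \in U}].

Section Subalgebra.
Variables (L : deMorganLatticeType d) (U : {pred L}).

(* The (unused) closure proof is what makes the instances below available. *)
Definition subalgebra (closedU : subuniverse U) : Type := {x : L | x \in U}.

Variable closedU : subuniverse U.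
Local Notation S := (subalgebra closedU).

HB.instance Definition _ := SubChoice.on S.

Let closedI : Order.ClosedPredicates.meet_closed U. Proof. by case: closedU. Qed.
Let closedJ : Order.ClosedPredicates.join_closed U. Proof. by case: closedU. Qed.
Let closedN (x : S) : neg (val x) \in U.
Proof. by case: closedU => _ _ ->//; exact: valP. Qed.

HB.instance Definition _ :=
  Order.SubChoice_isSubLattice.Build d L (mem U) d S closedI closedJ.

Lemma val_subI (x y : S) : val (x `&` y) = val x `&` val y.
Proof. by []. Qed.
Lemma val_subU (x y : S) : val (x `|` y) = val x `|` val y.
Proof. by []. Qed.

Let sub_meetUl : @left_distributive S S Order.meet Order.join.
Proof.
by move=> x y z; apply: val_inj; rewrite !(val_subI, val_subU) meetUl.
Qed.

HB.instance Definition _ :=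
  Order.Lattice_Meet_isDistrLattice.Build d S sub_meetUl.

Definition sub_neg (x : S) : S := exist _ (neg (val x)) (closedN x).

Let sub_negK : involutive sub_neg.
Proof. by move=> x; apply: val_inj => /=; rewrite negK. Qed.
Let sub_negU (x y : S) : sub_neg (x `|` y) = sub_neg x `&` sub_neg y.
Proof.
by apply: val_inj; rewrite val_subI -[LHS]/(neg (val _)) val_subU negU.
Qed.
Let sub_negI (x y : S) : sub_neg (x `&` y) = sub_neg x `|` sub_neg y.
Proof.
by apply: val_inj; rewrite val_subU -[LHS]/(neg (val _)) val_subI negI.
Qed.

HB.instance Definition _ :=
  hasDeMorganNeg.Build d S sub_negK sub_negU sub_negI.
End Subalgebra.

Definition substructure (A : structure d) (U : {pred A})
    (closedU : subuniverse U) : structure d :=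
  @Structure d (subalgebra closedU)
    ((val : subalgebra closedU -> A) @^-1` designated A)%classic.
End Substructure.

Section DualPower.
Variables (I : Type) (d : Order.disp_t).

(* I -> L carries the pointwise lattice structure declared in boolp. *)
Section PowerAlgebra.
Variable L : deMorganLatticeType d.

Let fun_meetUl : @left_distributive (I -> L) (I -> L) Order.meet Order.join.
Proof.
by move=> f g h; apply/funext => i; rewrite !(meetfE, joinfE) meetUl.
Qed.

HB.instance Definition _ :=
  Order.Lattice_Meet_isDistrLattice.Build _ (I -> L) fun_meetUl.

Definition fun_neg (f : I -> L) : I -> L := fun i => neg (f i).

Let fun_negK : involutive fun_neg.
Proof. by move=> f; apply/funext => i; rewrite /fun_neg negK. Qed.
Let fun_negU (f g : I -> L) : fun_neg (f `|` g) = fun_neg f `&` fun_neg g.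
Proof. by apply/funext => i; rewrite /fun_neg meetfE joinfE negU. Qed.
Let fun_negI (f g : I -> L) : fun_neg (f `&` g) = fun_neg f `|` fun_neg g.
Proof. by apply/funext => i; rewrite /fun_neg meetfE joinfE negI. Qed.

HB.instance Definition _ :=
  hasDeMorganNeg.Build _ (I -> L) fun_negK fun_negU fun_negI.
End PowerAlgebra.

Definition dual_power_over (A : structure d) :=
  @Structure _ (I -> A : deMorganLatticeType _)
    (\bigcup_(i in [set: I]) ((fun a : I -> A => a i) @^-1` designated A))%classic.
End DualPower.

Definition dual_power (d : Order.disp_t) (n : nat) (A : structure d) :=
  dual_power_over 'I_n A.

Inductive dm4 := DMf | DMn | DMb | DMt.

Definition dm4_code (x : dm4) : bool * bool :=
  match x with
  | DMf => (false, false) | DMn => (true, false)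
  | DMb => (false, true)  | DMt => (true, true)
  end.
Definition dm4_decode (c : bool * bool) : dm4 :=
  match c with
  | (false, false) => DMf | (true, false) => DMn
  | (false, true) => DMb  | (true, true) => DMt
  end.
Lemma dm4_codeK : cancel dm4_code dm4_decode. Proof. by case. Qed.

HB.instance Definition _ := Finite.copy dm4 (can_type dm4_codeK).

Definition dm4_le (x y : dm4) : bool :=
  match x, y with
  | DMf, _ | _, DMt | DMn, DMn | DMb, DMb => true
  | _, _ => false
  end.
Definition dm4_lt (x y : dm4) : bool := (y != x) && dm4_le x y.
Definition dm4_meet (x y : dm4) : dm4 :=
  if dm4_le x y then x else if dm4_le y x then y else DMf.
Definition dm4_join (x y : dm4) : dm4 :=
  if dm4_le x y then y else if dm4_le y x then x else DMt.
Definition dm4_neg (x : dm4) : dm4 :=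
  match x with DMf => DMt | DMn => DMn | DMb => DMb | DMt => DMf end.

Fact dm4_display : Order.disp_t. Proof. exact: (Order.Disp tt tt). Qed.

Section DM4Lattice.
Let le_def x y : dm4_le x y = (dm4_meet x y == x).
Proof. by case: x; case: y. Qed.
Let lt_def x y : dm4_lt x y = (y != x) && dm4_le x y.
Proof. by []. Qed.
Let meetC : commutative dm4_meet. Proof. by do 2!case. Qed.
Let joinC : commutative dm4_join. Proof. by do 2!case. Qed.
Let meetA : associative dm4_meet. Proof. by do 3!case. Qed.
Let joinA : associative dm4_join. Proof. by do 3!case. Qed.
Let joinKI y x : dm4_meet x (dm4_join x y) = x.
Proof. by case: x; case: y. Qed.
Let meetKU y x : dm4_join x (dm4_meet x y) = x.
Proof. by case: x; case: y. Qed.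
Let meetUl : left_distributive dm4_meet dm4_join. Proof. by do 3!case. Qed.
Let meetxx : idempotent_op dm4_meet. Proof. by case. Qed.

HB.instance Definition _ := Order.isMeetJoinDistrLattice.Build dm4_display dm4
  le_def lt_def meetC joinC meetA joinA joinKI meetKU meetUl meetxx.

Let negK : involutive dm4_neg. Proof. by case. Qed.
Let negU (x y : dm4) : dm4_neg (x `|` y) = dm4_neg x `&` dm4_neg y.
Proof. by case: x; case: y. Qed.
Let negI (x y : dm4) : dm4_neg (x `&` y) = dm4_neg x `|` dm4_neg y.
Proof. by case: x; case: y. Qed.

HB.instance Definition _ := hasDeMorganNeg.Build dm4_display dm4 negK negU negI.
End DM4Lattice.

Definition DM1 : structure dm4_display :=
  @Structure _ dm4 [set DMt; DMb]%classic.

Definition P1_universe : {pred DM1} := pred3 DMt DMb DMf.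
Definition K1_universe : {pred DM1} := pred3 DMt DMn DMf.
Definition B1_universe : {pred DM1} := pred2 DMt DMf.

Lemma P1_closed : subuniverse P1_universe.
Proof. by split; [case=> [] []|case=> [] []|case]. Qed.
Lemma K1_closed : subuniverse K1_universe.
Proof. by split; [case=> [] []|case=> [] []|case]. Qed.
Lemma B1_closed : subuniverse B1_universe.
Proof. by split; [case=> [] []|case=> [] []|case]. Qed.

Definition P1 : structure dm4_display := substructure P1_closed.
Definition K1 : structure dm4_display := substructure K1_closed.
Definition B1 : structure dm4_display := substructure B1_closed.

Section Filters.
Variables (d : Order.disp_t) (L : deMorganLatticeType d).
Implicit Types (F : set L) (X Y : {fset L}).

(* The lattice need not have a top element, so only non-empty meets make
   sense; the fold starts from some element of Y, which is harmless as the
   meet is idempotent (le_fset_meet). *)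
Definition fset_meet Y (Y0 : (Y != fset0)%fset) : L :=
  \big[Order.meet/xchoose (fset0Pn Y Y0)]_(y <- Y) y.

Lemma le_fset_meet Y (Y0 : (Y != fset0)%fset) (z : L) :
  (z <= fset_meet Y0) <-> (forall y, y \in Y -> z <= y).
Proof.
rewrite /fset_meet; have := xchooseP (fset0Pn Y Y0); set c := xchoose _ => cY.
have H (s : seq L) : z <= \big[Order.meet/c]_(y <- s) y =
    (z <= c) && all (fun y => z <= y) s.
  elim: s => [|a s IH]; rewrite ?big_nil ?andbT// big_cons lexI IH /=.
  by rewrite andbCA.
rewrite H; split=> [/andP[_ /allP]|zY]; first by [].
by rewrite zY//=; apply/allP.
Qed.

Definition upset F : Prop := forall x y : L, x <= y -> F x -> F y.

Definition n_filter (n : nat) F : Prop :=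
  upset F /\
  forall Y (Y0 : (Y != fset0)%fset),
    (forall X (X0 : (X != fset0)%fset),
       (X `<=` Y)%fset -> (#|` X| <= n)%N -> F (fset_meet X0)) ->
    F (fset_meet Y0).

Definition prime_upset F : Prop :=
  upset F /\ forall x y : L, F (x `|` y) -> F x \/ F y.

Definition almost_complete F : Prop :=
  upset F /\ forall x y : L, F x -> F (x `&` (y `|` neg y)).

Definition complete F : Prop := almost_complete F /\ (F !=set0)%classic.

Definition almost_consistent F : Prop :=
  upset F /\ forall x y : L, F ((x `&` neg x) `|` y) -> F y.

Definition consistent F : Prop :=
  almost_consistent F /\ F <> [set: L]%classic.

Definition classical F : Prop := complete F /\ consistent F.

Definition prime_n_filter (n : nat) F : Prop := n_filter n F /\ prime_upset F.

Definition hom_preimage (d' : Order.disp_t) (A : structure d') F : Prop :=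
  exists2 h : L -> A, demorgan_morphism h & F = (h @^-1` designated A)%classic.
End Filters.

(* Main.v *)
Require Import Defs.
From mathcomp Require Import all_boot all_order finmap.
From mathcomp Require Import boolp classical_sets.

(** Homomorphisms from [L] to [DM1] correspond to prime filters [U] of [L]
    (improper ones included): [x] is sent to the value coding the pair
    ([x] in [U], [neg x] in [U]).  It remains to see that the prime n-filters
    are the unions of [n] prime filters.  Call a finite subset of [F] orthogonal
    if any two distinct elements have their meet outside [F].  If [a_0, ..., a_n]
    were orthogonal in a prime n-filter [F], then any [n] of the [n + 1] joins
    [y_i] of the [a_j], [j != i], would have a lower bound [a_k] in [F], whereas
    by distributivity the meet of all of them lies below a join of meets
    [a_j `&` a_k], [j != k], hence outside [F].  So there is an orthogonal set
    [D] of maximal size, with at most [n] elements; by maximality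
    [{x | F (x `&` a)}] is a prime filter for each [a] in [D], and [F] is the
    union of these. *)

Set Implicit Arguments.
Unset Strict Implicit.
Unset Printing Implicit Defensive.

Import Order.TTheory.
Local Open Scope order_scope.

(** * Homomorphisms into dual powers, into substructures and into [DM1] *)

Section HomPreimages.
Variables (d : Order.disp_t) (L : deMorganLatticeType d).
Implicit Types (F U : set L) (x y : L).

(** A homomorphism into a power is a family of homomorphisms into the factor, and the dual power
    turns the designated sets into a union; all four claims thus become claims about unions of [n]
    sets. *)
Lemma hom_preimage_dual_power (d' : Order.disp_t) (A : structure d') n F :
  hom_preimage (dual_power n A) F <->
  exists2 U : 'I_n -> set L, forall i, hom_preimage A (U i) &
    forall x, F x <-> exists i, U i x.
Proof.
split=> [[h [hI hU hN] ->]|[U homU FU]].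
  exists (fun i x => designated A (h x i)) => [i|x]; last first.
    by split=> [[i _ hi]|[i hi]]; exists i.
  exists (fun x => h x i) => //; split=> [x y|x y|x].
  - by rewrite hI.
  - by rewrite hU.
  - by rewrite hN.
have /choice[g gP] i : exists h : L -> A,
    demorgan_morphism h /\ U i = (h @^-1` designated A)%classic.
  by have [h] := homU i; exists h.
exists (fun x i => g i x).
  split=> [x y|x y|x]; apply/funext => i; have [[gI gU gN] _] := gP i.
  - exact: gI.
  - exact: gU.
  - exact: gN.
apply/funext => x; apply/propext; rewrite FU; split=> [[i Ux]|[i _ gx]]; exists i => //.
  by have [_ Ui] := gP i; rewrite Ui in Ux.
by have [_ ->] := gP i.
Qed.

Lemma hom_preimage_substructure (d' : Order.disp_t) (A : structure d')
    (W : {pred A}) (closedW : subuniverse W) U :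
  hom_preimage (substructure closedW) U <->
  exists2 h : L -> A, demorgan_morphism h /\ (forall x, h x \in W) &
    U = (h @^-1` designated A)%classic.
Proof.
split=> [[h [hI hU hN] ->]|[h [[hI hU hN] hW] ->]].
  exists (fun x => val (h x)) => //; split; last by move=> x; exact: valP.
  split=> [x y|x y|x].
  - by rewrite hI val_subI.
  - by rewrite hU val_subU.
  - by rewrite hN.
exists (fun x => exist _ (h x) (hW x) : subalgebra closedW) => //.
split=> [x y|x y|x]; apply: val_inj.
- by rewrite val_subI /= hI.
- by rewrite val_subU /= hU.
- by rewrite /= hN.
Qed.

(** The empty set and all of [L] qualify; they come from the constant maps to [DMn] and [DMb]. *)
Definition prime_filter U : Prop :=
  prime_upset U /\ forall x y, U x -> U y -> U (x `&` y).

Lemma prime_filterI U : prime_filter U ->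
  forall x y, U (x `&` y) <-> U x /\ U y.
Proof.
move=> [[up _] UI] x y; split=> [Uxy|[]]; last exact: UI.
by split; apply: up Uxy; rewrite ?leIl ?leIr.
Qed.

Lemma prime_filterU U : prime_filter U ->
  forall x y, U (x `|` y) <-> U x \/ U y.
Proof.
move=> [[up Upr] _] x y; split=> [|[Ux|Uy]]; first exact: Upr.
- by apply: up Ux; rewrite leUl.
- by apply: up Uy; rewrite leUr.
Qed.

Definition dm4_of U x : dm4 :=
  match `[< U x >], `[< U (neg x) >] with
  | true, true => DMb | true, false => DMt
  | false, true => DMf | false, false => DMn
  end.

(** By De Morgan's laws and primeness, the memberships of a meet or join and of its negation depend
    only on those of the arguments and their negations; [neg] swaps the two. *)
Lemma dm4_of_morphism U : prime_filter U ->
  demorgan_morphism (dm4_of U : L -> DM1).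
Proof.
move=> pfU; have [EI EU] := (prime_filterI pfU, prime_filterU pfU).
split=> [x y|x y|x]; rewrite /dm4_of.
- rewrite negI (propext (EI _ _)) (propext (EU _ _)) asbool_and asbool_or.
  by do 4![case: asbool].
- rewrite negU (propext (EI _ _)) (propext (EU _ _)) asbool_and asbool_or.
  by do 4![case: asbool].
- by rewrite negK; do 2![case: asbool].
Qed.

Lemma dm4_of_preimage U : U = (dm4_of U @^-1` designated DM1)%classic.
Proof.
apply/funext => x; apply/propext; rewrite /dm4_of /preimage /=.
case: asboolP => Ux; case: asbool; split=> //; try (by left); try (by right).
- by case.
- by case.
Qed.

Lemma DM1_preimage_prime_filter (h : L -> DM1) : demorgan_morphism h ->
  prime_filter (h @^-1` designated DM1)%classic.
Proof.
move=> [hI hU hN].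
(* The designated set is the principal filter of [DMb], which is join-prime in [DM1]. *)
have E x : (h @^-1` designated DM1)%classic x <-> DMb <= h x.
  rewrite /preimage /=; case: (h x); split=> //; try (by left); try (by right).
  - by case.
  - by case.
split; first split.
- move=> x y /meet_l xy; rewrite !E => hx.
  by move: hx; rewrite -xy hI lexI => /andP[].
- by move=> x y; rewrite !E hU; case: (h x); case: (h y) => //; auto.
- by move=> x y; rewrite !E hI lexI => -> ->.
Qed.

Lemma hom_preimage_DM1 U : hom_preimage DM1 U <-> prime_filter U.
Proof.
split=> [[h hm ->]|pfU]; first exact: DM1_preimage_prime_filter.
by exists (dm4_of U); [exact: dm4_of_morphism|exact: dm4_of_preimage].
Qed.

(** By primeness the extra condition puts [x] or [neg x] into [U], so that [dm4_of U] avoids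
    [DMn]. *)
Lemma hom_preimage_P1 U : hom_preimage P1 U <->
  prime_filter U /\ forall x, U (x `|` neg x).
Proof.
rewrite hom_preimage_substructure; split=> [[h [hm hW] ->]|[pfU Ux]].
  split=> [|x]; first exact: DM1_preimage_prime_filter.
  have [_ hU hN] := hm; rewrite /preimage /= hU hN.
  by have := hW x; case: (h x) => // _; [left|right|left].
exists (dm4_of U); last exact: dm4_of_preimage.
split=> [|x]; first exact: dm4_of_morphism.
have /(prime_filterU pfU) := Ux x; rewrite /dm4_of.
by case: asboolP => ?; case: asboolP => // ? [].
Qed.

(** Dually, the extra condition keeps [x] and [neg x] from both lying in [U], so that [dm4_of U]
    avoids [DMb]. *)
Lemma hom_preimage_K1 U : hom_preimage K1 U <->
  prime_filter U /\ forall x, ~ U (x `&` neg x).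
Proof.
rewrite hom_preimage_substructure; split=> [[h [hm hW] ->]|[pfU Ux]].
  split=> [|x]; first exact: DM1_preimage_prime_filter.
  have [hI _ hN] := hm; rewrite /preimage /= hI hN.
  by have := hW x; case: (h x) => // _ [].
exists (dm4_of U); last exact: dm4_of_preimage.
split=> [|x]; first exact: dm4_of_morphism.
have := Ux x; rewrite (prime_filterI pfU) /dm4_of.
by case: asboolP => ?; case: asboolP => // ? [].
Qed.

Lemma hom_preimage_B1 U : hom_preimage B1 U <->
  [/\ prime_filter U, forall x, U (x `|` neg x) & forall x, ~ U (x `&` neg x)].
Proof.
rewrite hom_preimage_substructure; split=> [[h [hm hW] ->]|[pfU UU UI]].
  split=> [|x|x]; first exact: DM1_preimage_prime_filter.
  - have [_ hU hN] := hm; rewrite /preimage /= hU hN.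
    by have := hW x; case: (h x) => // _; left.
  - have [hI _ hN] := hm; rewrite /preimage /= hI hN.
    by have := hW x; case: (h x) => // _ [].
exists (dm4_of U); last exact: dm4_of_preimage.
split=> [|x]; first exact: dm4_of_morphism.
have := UI x; have := UU x.
rewrite (prime_filterI pfU) (prime_filterU pfU) /dm4_of.
by case: asboolP => ?; case: asboolP => // ? [] // ? [].
Qed.

End HomPreimages.

(** * Unions of [n] prime filters *)

Section PrimeNFilters.
Variables (d : Order.disp_t) (L : deMorganLatticeType d).
Implicit Types (F U : set L) (x y : L) (D X Y : {fset L}).

Lemma prime_filter_fset_meet U Y (Y0 : (Y != fset0)%fset) : prime_filter U ->
  (forall y, y \in Y -> U y) -> U (fset_meet Y0).
Proof.
move=> [_ UI] UY; rewrite /fset_meet.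
have := xchooseP (fset0Pn Y Y0); set c := xchoose _ => cY.
by rewrite big_seq; elim/big_ind : _ => //; exact: UY.
Qed.

Lemma fset_meet_le Y (Y0 : (Y != fset0)%fset) y : y \in Y -> fset_meet Y0 <= y.
Proof. by apply: (le_fset_meet Y0 _).1; exact: lexx. Qed.

(** If the meet of [Y] is outside [F], every [U i] misses some [c i] in [Y]; the meet of these at
    most [n] elements then lies in no [U i], against the assumption on [Y]. *)
Lemma bigcup_prime_n_filter n (U : 'I_n -> set L) F : (0 < n)%N ->
  (forall i, prime_filter (U i)) -> (forall x, F x <-> exists i, U i x) ->
  prime_n_filter n F.
Proof.
move=> n_gt0 pfU FU.
have upF : upset F.
  move=> x y xy /FU[i Ux]; apply/FU; exists i.
  by have [[up _] _] := pfU i; exact: up Ux.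
split; split=> //; last first.
  move=> x y /FU[i /(prime_filterU (pfU i))[]] Ui; [left|right];
  by apply/FU; exists i.
move=> Y Y0 YF; apply: contrapT => nFY.
have /choice[c cP] i : exists y, y \in Y /\ ~ U i y.
  apply: contrapT => nex; apply: nFY; apply/FU; exists i.
  apply: prime_filter_fset_meet => // y yY.
  by apply: contrapT => nUy; apply: nex; exists y.
pose X := [fset c i | i in 'I_n]%fset.
have cX i : c i \in X by apply/imfsetP; exists i.
have X0 : (X != fset0)%fset by apply/fset0Pn; exists (c (Ordinal n_gt0)).
have /FU[i UX] : F (fset_meet X0).
  apply: YF; first by apply/fsubsetP => _ /imfsetP[i _ ->]; case: (cP i).
  by rewrite (leq_trans (leq_imfset_card _ _ _))//= -cardE card_ord.
have [_ []] := cP i; have [[up _] _] := pfU i.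
by apply: up UX; exact: fset_meet_le.
Qed.

(* The last clause is distributivity as seen by the prime upset [F]; it spares
   the expansion of a meet of joins. *)
Lemma prime_upset_join F (s : seq L) : prime_upset F -> s <> [::] ->
  exists y, (forall a, a \in s -> a <= y) /\
    forall z, F (z `&` y) -> exists2 a, a \in s & F (z `&` a).
Proof.
move=> [upF prF]; elim: s => [//|a [|b s] IH] _.
  exists a; split=> [x|z Fz]; first by rewrite inE => /eqP ->.
  by exists a; rewrite ?inE.
have [//|y [ley Fy]] := IH; exists (a `|` y); split=> [x|z].
  rewrite inE => /predU1P[->|/ley]; first exact: leUl.
  by move/le_trans; apply; exact: leUr.
rewrite meetUr => /prF[Fa|/Fy[x xs Fx]]; first by exists a; rewrite ?mem_head.
by exists x; rewrite // inE xs orbT.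
Qed.

(** * Orthogonal sets: bounded size and maximality *)

Definition orthogonal F D : Prop :=
  (forall a, a \in D -> F a) /\
  forall a b, a \in D -> b \in D -> F (a `&` b) -> a = b.

Lemma orthogonal_card_le n F D : (0 < n)%N -> prime_n_filter n F ->
  orthogonal F D -> (#|` D| <= n)%N.
Proof.
move=> n_gt0 [[upF nF] prF] [DF Dorth]; rewrite leqNgt; apply/negP => nD.
(* For [a] in [D], [y a] is a join of the rest of [D], non-empty since [D] has more than [n >= 1]
   elements; elsewhere it is arbitrary. *)
have /choice[y yP] a : exists y, a \in D ->
    (forall b, b \in D -> b != a -> b <= y) /\
    forall z, F (z `&` y) -> exists2 b, b \in D /\ b != a & F (z `&` b).
  case: (boolP (a \in D)) => aD; last by exists a.
  have Da0 : enum_fset (D `\ a)%fset <> [::].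
    move=> E; move: nD; rewrite (cardfsD1 a) aD.
    by rewrite [#|` (D `\ a)%fset|]/(size _) E ltnNge n_gt0.
  have [y [ley Fy]] := prime_upset_join prF Da0; exists y => _.
  split=> [b bD ba|z /Fy[b]]; first by apply: ley; rewrite !inE ba.
  by rewrite !inE => /andP[ba bD] Fzb; exists b.
pose Y := [fset y a | a in D]%fset.
have yY a : a \in D -> y a \in Y by move=> aD; apply/imfsetP; exists a.
have [a0 a0D] : exists a, a \in D.
  by apply/fset0Pn; rewrite -cardfs_gt0 (leq_ltn_trans _ nD).
have Y0 : (Y != fset0)%fset by apply/fset0Pn; exists (y a0); exact: yY.
set z := fset_meet Y0.
have Fz : F z.
  apply: nF => X X0 /fsubsetP XY Xn.
  have /choice[g gP] x : exists a, x \in X -> a \in D /\ x = y a.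
    case: (boolP (x \in X)) => [/XY/imfsetP[a /= aD ->]|_]; last by exists x.
    by exists a.
  (* [X] uses at most [n] indices, so some [k] in [D] is left over; it lies below every element of
     [X]. *)
  have [k kD kg] : exists2 k, k \in D & k \notin [fset g x | x in X]%fset.
    apply: contrapT => nex; move: nD; rewrite ltnNge => /negP; apply.
    have gX : (#|` [fset g x | x in X]%fset| <= #|` X|)%N.
      exact: leq_imfset_card.
    apply: leq_trans Xn; apply: leq_trans gX.
    apply: fsubset_leq_card; apply/fsubsetP => k kD.
    by apply: contrapT => /negP kg; apply: nex; exists k.
  apply: (upF k); last exact: DF.
  apply/le_fset_meet => x xX; have [gD ->] := gP x xX.
  have [ley _] := yP _ gD; apply: ley => //.
  by apply: contraNneq kg => ->; apply/imfsetP; exists x.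
have lez a : a \in D -> z <= y a by move=> /yY; exact: fset_meet_le.
have step a x : a \in D -> x <= z -> F x ->
    exists2 b, b \in D /\ b != a & F (x `&` b).
  move=> aD xz Fx; have [_ Fy] := yP a aD; apply: Fy.
  by rewrite meet_l// (le_trans xz)// lez.
(* Using [step] at an arbitrary [a0] and then at the resulting [b] yields distinct [b], [c] in [D]
   whose meet is in [F]. *)
have [b [bD _] Fzb] := step _ _ a0D (lexx z) Fz.
have [c [cD /eqP cb] Fzbc] := step _ _ bD (leIl z b) Fzb.
apply: cb; apply: Dorth => //.
by apply: upF Fzbc; rewrite meetC leI2// leIr.
Qed.

Lemma orthogonalU1 F D x : orthogonal F D -> F x ->
  (forall a, a \in D -> ~ F (x `&` a)) ->
  orthogonal F (x |` D)%fset /\ #|` (x |` D)%fset| = #|` D|.+1.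
Proof.
move=> [DF Dorth] Fx xD; split; last first.
  rewrite cardfsU1 (_ : x \notin D)//.
  by apply/negP => /xD; rewrite meetxx.
split=> [a|a b]; rewrite !inE.
  by move=> /predU1P[->//|/DF].
move=> /predU1P[->|aD] /predU1P[->|bD]//; last exact: Dorth.
- by move/(xD _ bD).
- by rewrite meetC => /(xD _ aD).
Qed.

Lemma orthogonalD1 F D a : orthogonal F D -> orthogonal F (D `\ a)%fset.
Proof.
move=> [DF Dorth]; split=> [b|b c]; rewrite !inE.
  by move=> /andP[_ /DF].
by move=> /andP[_ bD] /andP[_ cD]; exact: Dorth.
Qed.

(** Primeness is inherited from [F] by distributivity; maximality serves closure under meets. *)
Lemma maximal_orthogonal_prime_filter F D a : prime_upset F -> orthogonal F D ->
  (forall D', orthogonal F D' -> (#|` D'| <= #|` D|)%N) -> a \in D ->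
  prime_filter (fun x => F (x `&` a)).
Proof.
move=> [upF prF] oD maxD aD; split; first split.
- by move=> x y xy; apply: upF; rewrite leI2.
- by move=> x y; rewrite meetUl; exact: prF.
move=> x y Fx Fy; apply: contrapT => nFxy.
(* otherwise [a] could be split into [x `&` a] and [y `&` a] *)
have aP z b : b \in (D `\ a)%fset -> ~ F ((z `&` a) `&` b).
  rewrite !inE => /andP[/eqP ba bD] Fab; apply: ba; apply/esym.
  by apply: oD.2 => //; apply: upF Fab; rewrite leI2// leIr.
have [oD1 cD1] := orthogonalU1 (orthogonalD1 a oD) Fx (aP x).
have [||oD2 cD2] := orthogonalU1 (x := y `&` a) oD1 => //.
  move=> b; rewrite in_fset1U => /predU1P[->|]; last exact: aP.
  by rewrite meetACA meetxx (meetC y).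
(* One element removed and two added: an orthogonal set with one element more than [D]. *)
by move: (maxD _ oD2); rewrite cD2 cD1 (cardfsD1 a D) aD ltnn.
Qed.

(** The family has exactly [n] members, as the dual power demands, so a smaller [D] is listed with
    repetition. The last clause serves the complete case. *)
Lemma prime_n_filter_bigcup n F : inhabited L -> (0 < n)%N ->
  prime_n_filter n F ->
  exists2 a : 'I_n -> L, forall i, prime_filter (fun x => F (x `&` a i)) &
    [/\ forall x, F x <-> exists i, F (x `&` a i) &
        (F !=set0)%classic -> forall i, F (a i)].
Proof.
move=> [l0] n_gt0 pnF; have [_ prF] := pnF; have [upF _] := prF.
pose P k := `[< exists2 D, orthogonal F D & #|` D| = k >].
have exP : exists k, P k.
  by exists 0; apply/asboolP; exists fset0; rewrite ?cardfs0//; split=> a.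
have ubP k : P k -> (k <= n)%N.
  by move=> /asboolP[D oD <-]; exact: orthogonal_card_le oD.
case: (ex_maxnP exP ubP) => k /asboolP[D oD cD] maxk.
have maxD D' : orthogonal F D' -> (#|` D'| <= #|` D|)%N.
  by move=> oD'; rewrite cD; apply: maxk; apply/asboolP; exists D'.
have Dn : (#|` D| <= n)%N by rewrite cD; apply: ubP; apply/asboolP; exists D.
(* Otherwise [x] could be added to [D]. *)
have FD x : F x -> exists2 a, a \in D & F (x `&` a).
  move=> Fx; apply: contrapT => nex.
  have [|oD' cD'] := orthogonalU1 oD Fx.
    by move=> a aD Fxa; apply: nex; exists a.
  by move: (maxD _ oD'); rewrite cD' ltnn.
(* Indices beyond the size of [D] repeat its first element; [l0] occurs only when [D], and hence
   [F], is empty. *)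
pose a (i : 'I_n) := nth (head l0 D) D i.
have aD i : (F !=set0)%classic -> a i \in D.
  move=> [x /FD[b bD _]].
  have D0 : (0 < size D)%N by rewrite cardfs_gt0; apply/fset0Pn; exists b.
  rewrite /a; case: (ltnP i (size D)) => iD; first exact: mem_nth.
  by rewrite nth_default// -nth0 mem_nth.
exists a => [i|]; last split=> [x|F0 i].
(* For empty [F] every member of the family is empty, a prime filter vacuously. *)
- case: (pselect (F !=set0)%classic) => [F0|F0].
    by apply: maximal_orthogonal_prime_filter maxD (aD i F0).
  have nF x : ~ F x by move=> Fx; apply: F0; exists x.
  split; [split=> [x y _|x y]|move=> x y]; by move=> /nF.
- split=> [/FD[b bD Fb]|[i]]; last by apply: upF; rewrite leIl.
  have bn : (index b D < n)%N by rewrite (leq_trans _ Dn)// index_mem.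
  by exists (Ordinal bn); rewrite /a nth_index.
- by apply: oD.1; exact: aD.
Qed.

(** If [x] meet [neg x] were in [F], so would be its join with any [y], hence every [y]. *)
Lemma consistent_prime_meet_neg F : prime_upset F -> consistent F ->
  forall x, ~ F (x `&` neg x).
Proof.
move=> [upF _] [[_ acF] FT] x Fx; apply: FT.
apply/funext => y; apply/propext; split=> // _.
by apply: (acF x); apply: upF Fx; rewrite leUl.
Qed.

Lemma bigcup_complete n (U : 'I_n -> set L) F : inhabited L -> (0 < n)%N ->
  (forall i, prime_filter (U i)) -> (forall x, F x <-> exists i, U i x) ->
  (forall i x, U i (x `|` neg x)) -> complete F.
Proof.
move=> [l0] n_gt0 pfU FU UU; have [[upF _] _] := bigcup_prime_n_filter n_gt0 pfU FU.
split; last by exists (l0 `|` neg l0); apply/FU; exists (Ordinal n_gt0).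
split=> // x y /FU[i Ux]; apply/FU; exists i.
by apply/(prime_filterI (pfU i)).
Qed.

(** As [F] is prime and [x] meet [neg x] lies in no [U i], a join with it can be in [F] only through
    the other argument. *)
Lemma bigcup_consistent n (U : 'I_n -> set L) F : inhabited L -> (0 < n)%N ->
  (forall i, prime_filter (U i)) -> (forall x, F x <-> exists i, U i x) ->
  (forall i x, ~ U i (x `&` neg x)) -> consistent F.
Proof.
move=> [l0] n_gt0 pfU FU UI.
have [[upF _] [_ prF]] := bigcup_prime_n_filter n_gt0 pfU FU.
have FI x : ~ F (x `&` neg x) by move=> /FU[i /UI].
split; last by move=> FT; apply: (FI l0); rewrite FT.
by split=> // x y /prF[/FI|].
Qed.

End PrimeNFilters.

Theorem mainTheorem1 (d : Order.disp_t) (L : deMorganLatticeType d)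
    (L_nonempty : inhabited L) (n : nat) (n_ge1 : (1 <= n)%N) (F : set L) :
  [/\ prime_n_filter n F <-> hom_preimage (dual_power n DM1) F,
      (prime_n_filter n F /\ complete F) <-> hom_preimage (dual_power n P1) F,
      (prime_n_filter n F /\ consistent F) <-> hom_preimage (dual_power n K1) F
    & (prime_n_filter n F /\ classical F) <-> hom_preimage (dual_power n B1) F].
Proof.
have UF a x : prime_n_filter n F -> F (x `&` a) -> F x.
  by move=> [[upF _] _]; apply: upF; rewrite leIl.
split; rewrite hom_preimage_dual_power; split.
- move=> pnF; have [a pfU [FU _]] := prime_n_filter_bigcup L_nonempty n_ge1 pnF.
  by exists (fun i x => F (x `&` a i)) => // i; apply/hom_preimage_DM1.
- move=> [U homU FU]; apply: bigcup_prime_n_filter FU => // i.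
  exact/hom_preimage_DM1.
- move=> [pnF [[_ cF] F0]].
  have [a pfU [FU Fa]] := prime_n_filter_bigcup L_nonempty n_ge1 pnF.
  exists (fun i x => F (x `&` a i)) => // i; apply/hom_preimage_P1; split=> // x.
  (* Almost completeness is applied to [a i] itself, which lies in [F]. *)
  by rewrite meetC; apply: cF; exact: Fa.
- move=> [U homU FU].
  have [pfU UU] : (forall i, prime_filter (U i)) /\
      forall i x, U i (x `|` neg x).
    by split=> i; have /hom_preimage_P1[] := homU i.
  by split; [exact: bigcup_prime_n_filter FU|exact: bigcup_complete FU _].
- move=> [pnF cF]; have FI := consistent_prime_meet_neg pnF.2 cF.
  have [a pfU [FU _]] := prime_n_filter_bigcup L_nonempty n_ge1 pnF.
  exists (fun i x => F (x `&` a i)) => // i; apply/hom_preimage_K1; split=> // x.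
  (* Each prime filter of the family is contained in [F], so it inherits the absence of
     contradictions. *)
  by move=> /UF-/(_ pnF)/FI.
- move=> [U homU FU].
  have [pfU UI] : (forall i, prime_filter (U i)) /\
      forall i x, ~ U i (x `&` neg x).
    by split=> i; have /hom_preimage_K1[] := homU i.
  by split; [exact: bigcup_prime_n_filter FU|exact: bigcup_consistent FU _].
- move=> [pnF [[[_ acF] F0] cF]]; have FI := consistent_prime_meet_neg pnF.2 cF.
  have [a pfU [FU Fa]] := prime_n_filter_bigcup L_nonempty n_ge1 pnF.
  exists (fun i x => F (x `&` a i)) => // i; apply/hom_preimage_B1; split=> // x.
    by rewrite meetC; apply: acF; exact: Fa.
  by move=> /UF-/(_ pnF)/FI.
- move=> [U homU FU].
  have [pfU UU UI] : [/\ forall i, prime_filter (U i),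
      forall i x, U i (x `|` neg x) & forall i x, ~ U i (x `&` neg x)].
    by split=> i; have /hom_preimage_B1[] := homU i.
  split; first exact: bigcup_prime_n_filter FU.
  by split; [exact: bigcup_complete FU _|exact: bigcup_consistent FU _].
Qed.
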